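(* The choice $m=d$ minimizes $m\mapsto\sqrt m+\frac{d}{\sqrt m}$ over $m\geq 1$, i.e. it minimizes over $m$ the upper bound $\mathcal{O}\bigl((\sqrt m+\frac d{\sqrt m})\frac{\sqrt L(f(\mathbf{x}_0)-f^\star)}{\varepsilon^{3/2}}\bigr)\cdot\mathtt{GradCost}$ on the total arithmetic complexity of the Cubic Newton method with Lazy Hessians. Moreover, there is an absolute constant $C>0$ such that for $m=d$ (and $M=6dL$) and every $\varepsilon>0$ with $\varepsilon\le(f(\mathbf{x}_0)-f^\star)^{2/3}(L/d)^{1/3}$, the following holds: if $k\ge1$ is such that $\|\nabla f(\mathbf{x}_i)\|_*\ge\varepsilon$ for all $1\le i\le k$, then the total arithmetic complexity of the first $k$ iterations is at most $$C\,\sqrt d\;\frac{\sqrt L\,(f(\mathbf{x}_0)-f^\star)}{\varepsilon^{3/2}}\cdot\mathtt{GradCost}.$$ (This improves by a factor $\sqrt d$ upon the bound $\mathcal{O}\bigl(d\,\frac{\sqrt L(f(\mathbf{x}_0)-f^\star)}{\varepsilon^{3/2}}\bigr)\cdot\mathtt{GradCost}$ corresponding to $m=1$, the full Cubic Newton method.)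
   Context: $\mathbf{B}\in\mathbb{R}^{d\times d}$ is a fixed symmetric positive definite matrix, $\|\mathbf{x}\|=\langle \mathbf{B}\mathbf{x},\mathbf{x}\rangle^{1/2}$, $\|\mathbf{g}\|_*=\langle \mathbf{g},\mathbf{B}^{-1}\mathbf{g}\rangle^{1/2}$ for gradients, and $\|\mathbf{A}\|=\sup_{\|\mathbf{x}\|\le1}\|\mathbf{A}\mathbf{x}\|_*$ for matrices. The function $f:\mathbb{R}^d\to\mathbb{R}$ (not necessarily convex) is twice continuously differentiable, $\inf f\ge f^\star\in\mathbb{R}$, and $\|\nabla^2 f(\mathbf{x})-\nabla^2 f(\mathbf{y})\|\le L\|\mathbf{x}-\mathbf{y}\|$ for all $\mathbf{x},\mathbf{y}$, with $L>0$. For $M>0$, $\mathbf{T}_M(\mathbf{x},\mathbf{z})$ denotes a global minimizer over $\mathbf{y}\in\mathbb{R}^d$ of $\langle\nabla f(\mathbf{x}),\mathbf{y}-\mathbf{x}\rangle+\frac12\langle\nabla^2 f(\mathbf{z})(\mathbf{y}-\mathbf{x}),\mathbf{y}-\mathbf{x}\rangle+\frac M6\|\mathbf{y}-\mathbf{x}\|^3$. Cubic Newton with Lazy Hessians (integer $m\ge1$, $M=6mL$): given $\mathbf{x}_0\in\mathbb{R}^d$, for $k=0,1,\dots$ set $\mathbf{z}_k=\mathbf{x}_{\pi(k)}$ and $\mathbf{x}_{k+1}=\mathbf{T}_M(\mathbf{x}_k,\mathbf{z}_k)$, where $\pi(k)=k-(k\bmod m)$. Cost model: $\mathtt{GradCost}>0$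 is the arithmetic cost of one gradient step, $\mathtt{HessCost}$ is the cost of computing and factorizing one Hessian, and $\mathtt{HessCost}=d\cdot\mathtt{GradCost}$. The total arithmetic complexity of $k$ iterations is $k\cdot\mathtt{GradCost}+t\cdot\mathtt{HessCost}$, where $t=\lceil k/m\rceil$ is the number of Hessians computed. ''Absolute constant'' means independent of $d,\mathbf{B},f,L,\mathbf{x}_0,\varepsilon,k$. *)

(* Defs.v *)
From mathcomp Require Import all_boot all_order all_algebra.
From mathcomp Require Import all_classical all_reals all_analysis.

Set Implicit Arguments.
Unset Strict Implicit.
Unset Printing Implicit Defensive.

Import Order.TTheory GRing.Theory Num.Theory.
Import numFieldNormedType.Exports.

Local Open Scope classical_set_scope.
Local Open Scope ring_scope.

Section EuclideanNorms.
Variables (R : realType) (d : nat).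
Implicit Types (A B : 'M[R]_d) (u v x g : 'cV[R]_d).

Definition inner u v : R := (u^T *m v) 0 0.

Definition posdef B : Prop :=
  B^T = B /\ forall x, x != 0 -> 0 < inner (B *m x) x.

Definition bnorm B x : R := Num.sqrt (inner (B *m x) x).

Definition dual_norm B g : R := Num.sqrt (inner g (invmx B *m g)).

Definition op_norm B A : R :=
  sup [set dual_norm B (A *m x) | x in [set x | bnorm B x <= 1]].

End EuclideanNorms.

Section Smoothness.
Variables (R : realType) (d : nat).
Implicit Types (f : 'cV[R]_d -> R) (B : 'M[R]_d) (x : 'cV[R]_d).

Definition grad f x : 'cV[R]_d := \col_i 'D_(delta_mx i 0) f x.

(* Jacobian matrix of the gradient map: column j is its derivative along e_j. *)
Definition hess f x : 'M[R]_d :=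
  \matrix_(i, j) ('D_(delta_mx j 0) (grad f) x) i 0.

(* [differentiable] is Frechet differentiability; [grad] and [hess] above are
   total functions, meaningful only where it holds. *)
Definition twice_cont_diff f : Prop :=
  [/\ forall x, differentiable f x,
      forall x, differentiable (grad f) x &
      continuous (hess f)].

Definition hess_lipschitz B f (L : R) : Prop :=
  forall x y, op_norm B (hess f x - hess f y) <= L * bnorm B (x - y).

End Smoothness.

Section LazyCubicNewton.
Variables (R : realType) (d : nat).
Implicit Types (B : 'M[R]_d) (f : 'cV[R]_d -> R) (M : R).

Definition cubic_model B f M (x z y : 'cV[R]_d) : R :=
  inner (grad f x) (y - x) + 2^-1 * inner (hess f z *m (y - x)) (y - x)
  + M / 6 * bnorm B (y - x) ^+ 3.

(* [T] is a global minimizer of the model: a valid value of T_M(x, z).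
   Minimizers need not be unique, so the step is a relation. *)
Definition cubic_step B f M (x z T : 'cV[R]_d) : Prop :=
  forall y, cubic_model B f M x z T <= cubic_model B f M x z y.

Definition snapshot (m k : nat) : nat := (k - k %% m)%N.

Definition lazy_cubic_newton B f M (m : nat)
    (x0 : 'cV[R]_d) (x : nat -> 'cV[R]_d) : Prop :=
  x 0%N = x0 /\
  forall k, cubic_step B f M (x k) (x (snapshot m k)) (x k.+1).

End LazyCubicNewton.

Section Complexity.
Variable R : realType.

Definition num_hessians (m k : nat) : int := Num.ceil (k%:R / m%:R : R).

Definition total_cost (gradcost hesscost : R) (m k : nat) : R :=
  k%:R * gradcost + (num_hessians m k)%:~R * hesscost.

(* Every run from [x0] with M = 6 m L, and every k >= 1 such that the gradients
   at the iterates 1, ..., k have dual norm at least [eps], satisfy: the first k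
   iterations cost at most [U]. *)
Definition complexity_at_most (d : nat) (B : 'M[R]_d) (f : 'cV[R]_d -> R)
    (L gradcost hesscost : R) (x0 : 'cV[R]_d) (eps : R) (m : nat) (U : R) :
    Prop :=
  forall (x : nat -> 'cV[R]_d) (k : nat),
    lazy_cubic_newton B f (6 * m%:R * L) m x0 x ->
    (1 <= k)%N ->
    (forall i : nat, (1 <= i <= k)%N -> eps <= dual_norm B (grad f (x i))) ->
    total_cost gradcost hesscost m k <= U.

Definition tradeoff (d : nat) (s : R) : R := Num.sqrt s + d%:R / Num.sqrt s.

End Complexity.

(* Main.v *)
Require Import Defs.
From mathcomp Require Import all_boot all_order all_algebra.
From mathcomp Require Import all_classical all_reals all_analysis.
From mathcomp Require Import ring lra.

(** Write [h = T - x], [r = ||h||] for a step from [x] with snapshot [z].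
    Comparing the model at [h] and at [-h] gives [<grad f x, h> <= 0]; with the
    stationarity of [T] and the Taylor bounds this yields
    [f T <= f x - (M/4 - L/6) r^3 + L/2 ||x - z|| r^2] and
    [||grad f T||_* <= (L + M)/2 r^2 + L ||x - z|| r].  Since [||x - z||] is at
    most the sum of the previous step lengths in the same cycle, of which there
    are fewer than [m], summing over the iterations with [M = 6 m L] and using
    power mean inequalities gives [5/6 m L (sum r_i^3) <= f x_0 - f x_k] and
    [k eps^(3/2) <= 36 (m L)^(3/2) (sum r_i^3)], whence
    [k = O(sqrt m * sqrt L (f x_0 - fstar) / eps^(3/2))].  The upper bound imposed on
    [eps] says that [sqrt m <= sqrt L (f x_0 - fstar) / eps^(3/2)], which absorbs the
    rounding in [ceil (k / m)]. *)

Import Order.TTheory GRing.Theory Num.Theory.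
Import numFieldNormedType.Exports.

Local Open Scope ring_scope.

(** * The Euclidean pairing *)

Section Inner.
Context {R : realType} {d : nat}.
Implicit Types (A : 'M[R]_d) (u v w : 'cV[R]_d).

Lemma innerE u v : inner u v = \sum_i u i 0 * v i 0.
Proof. by rewrite /inner mxE; apply: eq_bigr => i _; rewrite mxE. Qed.

Lemma innerC u v : inner u v = inner v u.
Proof. by rewrite !innerE; apply: eq_bigr => i _; rewrite mulrC. Qed.

Lemma innerDl u v w : inner (u + v) w = inner u w + inner v w.
Proof. by rewrite /inner linearD mulmxDl mxE. Qed.

Lemma innerZl a u v : inner (a *: u) v = a * inner u v.
Proof. by rewrite /inner linearZ -scalemxAl mxE. Qed.

Lemma innerNl u v : inner (- u) v = - inner u v.
Proof. by rewrite -scaleN1r innerZl mulN1r. Qed.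

Lemma innerDr u v w : inner u (v + w) = inner u v + inner u w.
Proof. by rewrite innerC innerDl !(innerC u). Qed.

Lemma innerZr a u v : inner u (a *: v) = a * inner u v.
Proof. by rewrite innerC innerZl innerC. Qed.

Lemma innerNr u v : inner u (- v) = - inner u v.
Proof. by rewrite innerC innerNl innerC. Qed.

Lemma inner0l v : inner 0 v = 0.
Proof. by rewrite -(scale0r 0) innerZl mul0r. Qed.

Lemma inner_mull A u v : inner (A *m u) v = inner u (A^T *m v).
Proof. by rewrite /inner trmx_mul mulmxA. Qed.

Lemma inner_deltal i v : inner (delta_mx i 0) v = v i 0.
Proof.
rewrite innerE (bigD1 i) //= big1 ?addr0 => [|j ji]; first by rewrite mxE !eqxx mul1r.
by rewrite mxE (negbTE ji) mul0r.
Qed.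

Lemma colE_delta u : u = \sum_i u i 0 *: delta_mx i 0.
Proof.
rewrite {1}[u]matrix_sum_delta; apply: eq_bigr => i _.
by rewrite big_ord_recl big_ord0 addr0.
Qed.

Lemma mulmx_delta A u : A *m u = \sum_i u i 0 *: (A *m delta_mx i 0).
Proof.
by rewrite {1}[u]colE_delta mulmx_sumr; apply: eq_bigr => i _; rewrite scalemxAr.
Qed.

Lemma inner_suml n (F : 'I_n -> 'cV[R]_d) v :
  inner (\sum_i F i) v = \sum_i inner (F i) v.
Proof. by rewrite /inner linear_sum mulmx_suml summxE. Qed.

End Inner.

(** * The norm of [B], its dual norm and the operator norm *)

Section BNorm.
Context {R : realType} {d : nat} {B : 'M[R]_d}.
Hypothesis Bpos : posdef B.
Implicit Types (A : 'M[R]_d) (u v w g : 'cV[R]_d).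

Lemma innerB_sym u v : inner (B *m u) v = inner (B *m v) u.
Proof. by rewrite inner_mull (proj1 Bpos) innerC. Qed.

Lemma innerB_ge0 u : 0 <= inner (B *m u) u.
Proof.
have [->|/(proj2 Bpos)/ltW //] := eqVneq u 0.
by rewrite mulmx0 inner0l.
Qed.

Lemma bnorm_ge0 u : 0 <= bnorm B u. Proof. exact: sqrtr_ge0. Qed.

Lemma sqr_bnorm u : bnorm B u ^+ 2 = inner (B *m u) u.
Proof. by rewrite sqr_sqrtr ?innerB_ge0. Qed.

Lemma bnormZ a u : bnorm B (a *: u) = `|a| * bnorm B u.
Proof.
rewrite /bnorm -scalemxAr innerZl innerZr mulrA -expr2 sqrtrM ?sqr_ge0 //.
by rewrite sqrtr_sqr.
Qed.

Lemma bnormN u : bnorm B (- u) = bnorm B u.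
Proof. by rewrite -scaleN1r bnormZ normrN1 mul1r. Qed.

Lemma bnorm_eq0 u : bnorm B u = 0 -> u = 0.
Proof.
move=> u0; apply/eqP; apply: contraT => /(proj2 Bpos).
by rewrite -sqr_bnorm u0 expr0n ltxx.
Qed.

(** Cauchy-Schwarz, from the nonnegative square of [||v|| u - ||u|| v]; dividing by [||u|| ||v||]
    forces the degenerate cases apart. *)
Lemma innerB_le u v : inner (B *m u) v <= bnorm B u * bnorm B v.
Proof.
have [/bnorm_eq0 ->|v0] := eqVneq (bnorm B v) 0.
  by rewrite innerB_sym mulmx0 inner0l mulr_ge0 ?bnorm_ge0.
have [/bnorm_eq0 ->|u0] := eqVneq (bnorm B u) 0.
  by rewrite mulmx0 inner0l mulr_ge0 ?bnorm_ge0.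
have up : 0 < bnorm B u by rewrite lt_neqAle eq_sym u0 bnorm_ge0.
have vp : 0 < bnorm B v by rewrite lt_neqAle eq_sym v0 bnorm_ge0.
have := innerB_ge0 (bnorm B v *: u - bnorm B u *: v).
rewrite mulmxDr mulmxN -!scalemxAr !(innerDl, innerDr, innerNl, innerNr, innerZl, innerZr).
rewrite -!sqr_bnorm (innerB_sym v u).
move=> h; rewrite -subr_ge0 -(pmulr_rge0 _ (mulr_gt0 up vp)); nra.
Qed.

Lemma bnormD u v : bnorm B (u + v) <= bnorm B u + bnorm B v.
Proof.
rewrite -(ler_pXn2r (n := 2)) ?nnegrE ?addr_ge0 ?bnorm_ge0 //.
rewrite sqr_bnorm mulmxDr !(innerDl, innerDr) (innerB_sym v u).
have := innerB_le u v; rewrite -!sqr_bnorm; lra.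
Qed.

Lemma bnorm_dist u v : `|bnorm B (u + v) - bnorm B u| <= bnorm B v.
Proof.
rewrite ler_norml; have := bnormD u v; have := bnormD (u + v) (- v).
rewrite addrK bnormN; lra.
Qed.

Lemma posdef_unit : B \in unitmx.
Proof.
rewrite -row_free_unit -kermx_eq0; apply/rowV0P => v /sub_kermxP vB.
have Bv : B *m v^T = 0 by rewrite -(proj1 Bpos) -trmx_mul vB trmx0.
rewrite -[v]trmxK [v^T]bnorm_eq0 ?trmx0 //.
by rewrite /bnorm Bv inner0l sqrtr0.
Qed.

Lemma dual_normE g : dual_norm B g = bnorm B (invmx B *m g).
Proof.
by rewrite /dual_norm /bnorm mulmxA mulmxV ?posdef_unit // mul1mx.
Qed.

Lemma dual_norm_ge0 g : 0 <= dual_norm B g. Proof. exact: sqrtr_ge0. Qed.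

Lemma inner_le_dual g v : inner g v <= dual_norm B g * bnorm B v.
Proof.
rewrite dual_normE -{1}[g]mul1mx -(mulmxV posdef_unit) -mulmxA.
exact: innerB_le.
Qed.

Lemma inner_abs_le g v : `|inner g v| <= dual_norm B g * bnorm B v.
Proof.
rewrite ler_norml inner_le_dual andbT lerNl -innerNr.
by have := inner_le_dual g (- v); rewrite bnormN.
Qed.

(** Testing with [v = B^-1 g] gives [||g||_*^2 <= c ||g||_*]. Every later dual norm estimate thus
    reduces to a scalar one in a fixed direction. *)
Lemma dual_norm_le g c : 0 <= c ->
  (forall v, inner g v <= c * bnorm B v) -> dual_norm B g <= c.
Proof.
move=> c0 h; have := h (invmx B *m g); rewrite -dual_normE.
have -> : inner g (invmx B *m g) = dual_norm B g ^+ 2.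
  by rewrite dual_normE sqr_bnorm mulmxA mulmxV ?posdef_unit // mul1mx.
have [-> //|g0] := eqVneq (dual_norm B g) 0.
by rewrite expr2 ler_pM2r // lt_neqAle eq_sym g0 dual_norm_ge0.
Qed.

Lemma dual_normZ a g : dual_norm B (a *: g) = `|a| * dual_norm B g.
Proof. by rewrite !dual_normE -scalemxAr bnormZ. Qed.

(** [sup] is meaningful only on a nonempty set bounded above. On the unit ball each coordinate
    [x i 0] is at most the dual norm of the basis vector, so expanding [A *m x] in the basis gives a
    bound. *)
Lemma op_norm_has_sup A :
  has_sup [set dual_norm B (A *m x) | x in [set x | bnorm B x <= 1]]%classic.
Proof.
split.
  exists (dual_norm B (A *m 0)), 0 => //=.
  by rewrite /bnorm mulmx0 inner0l sqrtr0.
exists (\sum_i dual_norm B (delta_mx i 0) * dual_norm B (A *m delta_mx i 0)).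
move=> _ [x /= x1 <-]; apply: dual_norm_le => [|v].
  by apply: sumr_ge0 => i _; rewrite mulr_ge0 ?dual_norm_ge0.
rewrite mulmx_delta inner_suml mulr_suml; apply: ler_sum => i _.
rewrite innerZl -[x i 0]inner_deltal; apply: le_trans (ler_norm _) _.
rewrite normrM -mulrA ler_pM ?normr_ge0 ?inner_abs_le //.
apply: le_trans (inner_abs_le _ _) _.
by rewrite ler_piMr ?dual_norm_ge0.
Qed.

Lemma dual_norm_mul_le A x : dual_norm B (A *m x) <= op_norm B A * bnorm B x.
Proof.
have [/bnorm_eq0 ->|x0] := eqVneq (bnorm B x) 0.
  by rewrite mulmx0 /dual_norm inner0l sqrtr0 /bnorm mulmx0 inner0l sqrtr0 mulr0.
have xp : 0 < bnorm B x by rewrite lt_neqAle eq_sym x0 bnorm_ge0.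
rewrite -ler_pdivrMr // mulrC -[_^-1]ger0_norm ?invr_ge0 ?bnorm_ge0 //.
rewrite -dual_normZ scalemxAr; apply: (ub_le_sup (proj2 (op_norm_has_sup A))).
exists ((bnorm B x)^-1 *: x) => //=.
by rewrite bnormZ ger0_norm ?invr_ge0 ?bnorm_ge0 // mulVf.
Qed.

Lemma inner_mul_le A u v :
  `|inner (A *m u) v| <= op_norm B A * bnorm B u * bnorm B v.
Proof.
apply: le_trans (inner_abs_le _ _) _.
by rewrite ler_wpM2r ?bnorm_ge0 ?dual_norm_mul_le.
Qed.

End BNorm.

(** * Derivatives along lines *)

Lemma is_derive_line {R : numFieldType} {V W : normedModType R} (F : V -> W)
    (x h : V) (t : R) (D : W) :
  is_derive (x + t *: h) h F D ->
  is_derive t (1 : R) (fun s : R => F (x + s *: h)) D.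
Proof.
have E : (fun r : R => r^-1 *: (((fun s : R => F (x + s *: h)) \o shift t) (r *: (1 : R))
              - F (x + t *: h))) =
         (fun r : R => r^-1 *: ((F \o shift (x + t *: h)) (r *: h) - F (x + t *: h))).
  apply/funext => r /=; congr (_ *: (F _ - _)).
  by rewrite /shift /= [_%:A]mulr1 scalerDl addrCA.
by case=> [dF <-]; split; rewrite ?/derivable ?/derive E.
Qed.

Lemma is_derive_inner {R : realType} {d : nat} (G : R -> 'cV[R]_d) (t : R) D v :
  is_derive t (1 : R) G D ->
  is_derive t (1 : R) (fun s => inner (G s) v) (inner D v).
Proof.
move=> [dG GD].
have dGi i : is_derive t (1 : R) (fun s => G s i 0) (D i 0).
  split; first exact: (proj1 (derivable_mxP _ _ _) dG).
  by rewrite -GD derive_mx // mxE.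
have -> : (fun s => inner (G s) v) = \sum_i (v i 0 \*: (fun s => G s i 0)).
  apply/funext => s; rewrite innerE fct_sumE; apply: eq_bigr => i _.
  by rewrite mulrC.
apply: is_derive_eq; rewrite innerE; apply: eq_bigr => i _.
by rewrite mulrC.
Qed.

(** The mean value theorem for [p - q]. It replaces integration in the Taylor bounds, with a
    polynomial on one side. *)
Lemma is_derive_cmp {R : realType} (p q p' q' : R -> R) :
  (forall t : R, is_derive t (1 : R) p (p' t)) ->
  (forall t : R, is_derive t (1 : R) q (q' t)) ->
  (forall t : R, 0 <= t <= 1 -> p' t <= q' t) ->
  p 1 - p 0 <= q 1 - q 0.
Proof.
move=> dp dq le_pq.
have dpq (t : R) : is_derive t (1 : R) (p - q) (p' t - q' t).
  exact: (is_deriveB (dp t) (dq t)).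
have cpq : ({within `[0, 1], continuous (p - q)})%classic.
  apply: continuous_subspaceT => s.
  apply: differentiable_continuous; apply/derivable1_diffP.
  by have [] := dpq s.
have [c] := MVT ltr01 (fun t _ => dpq t) cpq.
rewrite in_itv /= => /andP[c0 c1]; rewrite subr0 mulr1 => E.
have h : p' c <= q' c by apply: le_pq; rewrite !ltW.
have : (p - q) 1 - (p - q) 0 = (p 1 - p 0) - (q 1 - q 0).
  change (p 1 - q 1 - (p 0 - q 0) = (p 1 - p 0) - (q 1 - q 0)); ring.
lra.
Qed.

Section Lines.
Context {R : realType} {d : nat}.
Implicit Types (f : 'cV[R]_d -> R) (x h v : 'cV[R]_d).

Lemma derive_grad f x h : differentiable f x ->
  is_derive x h f (inner (grad f x) h).
Proof.
move=> df; split; first exact: diff_derivable.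
rewrite deriveE // {1}[h]colE_delta linear_sum innerE; apply: eq_bigr => i _.
by rewrite linearZ mxE deriveE // mulrC.
Qed.

Lemma derive_hess f x h : differentiable (grad f) x ->
  is_derive x h (grad f) (hess f x *m h).
Proof.
move=> df; split; first exact: diff_derivable.
rewrite deriveE // {1}[h]colE_delta linear_sum.
apply/matrixP => i j; rewrite ord1 summxE !mxE; apply: eq_bigr => k _.
by rewrite linearZ !mxE deriveE // mulrC.
Qed.

End Lines.

Lemma is_derive_cubic {R : realType} (a b c t : R) :
  is_derive t (1 : R) (fun s => a * s + b * s ^+ 2 + c * s ^+ 3)
    (a + 2 * b * t + 3 * c * t ^+ 2).
Proof.
have -> : (fun s : R => a * s + b * s ^+ 2 + c * s ^+ 3) =
  a \*: (id : R -> R) + b \*: (id : R -> R) ^+ 2 + c \*: (id : R -> R) ^+ 3.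
  apply/funext => s; rewrite /= !fctE.
  by rewrite /GRing.scale.
apply: is_derive_eq; rewrite /GRing.scale /=; ring.
Qed.

(** * Taylor bounds under a Lipschitz Hessian, and symmetry of the Hessian *)

Section Taylor.
Context {R : realType} {d : nat} {B : 'M[R]_d} {f : 'cV[R]_d -> R} {L : R}.
Hypothesis Bpos : posdef B.
Hypothesis fC2 : twice_cont_diff f.
Hypothesis L0 : 0 < L.
Hypothesis fL : hess_lipschitz B f L.
Implicit Types (x y h u v : 'cV[R]_d).

Lemma hess_dist x y u v :
  `|inner (hess f x *m u) v - inner (hess f y *m u) v| <=
  L * bnorm B (x - y) * bnorm B u * bnorm B v.
Proof.
rewrite -innerNl -innerDl -mulmxBl.
apply: le_trans (inner_mul_le Bpos _ _ _) _.
by rewrite !ler_wpM2r ?bnorm_ge0 ?fL.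
Qed.

(** Along [x + t h] the derivative of [<grad f, v>] exceeds [<H h, v>] by at most
    [L t ||h||^2 ||v||], the derivative of the quadratic term of the comparison polynomial. *)
Lemma grad_taylor_le x h v :
  inner (grad f (x + h)) v <=
  inner (grad f x) v + inner (hess f x *m h) v
  + L / 2 * bnorm B h ^+ 2 * bnorm B v.
Proof.
have [_ dg _] := fC2.
have dp (t : R) := is_derive_inner _ _ _ v
  (is_derive_line _ _ _ _ _ (derive_hess _ _ h (dg (x + t *: h)))).
have dq := is_derive_cubic (inner (hess f x *m h) v)
  (L / 2 * bnorm B h ^+ 2 * bnorm B v) 0.
have /= := is_derive_cmp _ _ _ _ dp dq.
rewrite !(scale1r, scale0r, addr0, mul0r, mulr0, expr0n, expr1n, mulr1, subr0) /=.
rewrite lerBlDl addrA; apply => t /andP[t0 _].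
apply: le_trans (ler_distlDr (hess_dist _ x h v)) _.
rewrite addrC [x + _]addrC addrK bnormZ // ger0_norm //.
rewrite -subr_ge0 le_eqVlt; apply/orP; left; apply/eqP; by field.
Qed.

Lemma grad_taylor x h :
  dual_norm B (grad f (x + h) - grad f x - hess f x *m h) <=
  L / 2 * bnorm B h ^+ 2.
Proof.
apply: (dual_norm_le Bpos) => [|v].
  by rewrite mulr_ge0 ?exprn_ge0 ?bnorm_ge0 // divr_ge0 // ltW.
rewrite !innerDl !innerNl; have := grad_taylor_le x h v; lra.
Qed.

Lemma grad_taylor_dist x h v :
  `|inner (grad f (x + h)) v - inner (grad f x) v - inner (hess f x *m h) v|
  <= L / 2 * bnorm B h ^+ 2 * bnorm B v.
Proof.
rewrite -!innerNl -!innerDl.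
apply: le_trans (inner_abs_le Bpos _ _) _.
by rewrite ler_wpM2r ?bnorm_ge0 ?grad_taylor.
Qed.

Lemma fun_taylor x h :
  f (x + h) <= f x + inner (grad f x) h + 2^-1 * inner (hess f x *m h) h
               + L / 6 * bnorm B h ^+ 3.
Proof.
have [df _ _] := fC2.
have dp (t : R) := is_derive_line _ _ _ _ _ (derive_grad _ _ h (df (x + t *: h))).
have dq := is_derive_cubic (inner (grad f x) h)
  (2^-1 * inner (hess f x *m h) h) (L / 6 * bnorm B h ^+ 3).
have /= := is_derive_cmp _ _ _ _ dp dq.
rewrite !(scale1r, scale0r, addr0, mul0r, mulr0, expr0n, expr1n, mulr1, subr0) /=.
rewrite lerBlDl !addrA; apply => t /andP[t0 _].
apply: le_trans (grad_taylor_le _ _ _) _.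
rewrite -scalemxAr innerZl bnormZ // ger0_norm //.
rewrite -subr_ge0 le_eqVlt; apply/orP; left; apply/eqP; by field.
Qed.

Let second_diff x u v := f (x + u + v) - f (x + v) - (f (x + u) - f x).
Let K u v := L / 2 * (bnorm B u ^+ 2 * bnorm B v + bnorm B u * bnorm B v ^+ 2).

(* Integrating along [v] compares the second difference with [<H u, v>]; the
   second difference is symmetric in [u] and [v], whence [hess_sym]. *)
Lemma second_diff_bounds x u v :
  inner (hess f x *m u) v - K u v <= second_diff x u v
    <= inner (hess f x *m u) v + K u v.
Proof.
have [df _ _] := fC2.
pose p (t : R) := f (x + u + t *: v) - f (x + t *: v).
have dp (t : R) : is_derive t (1 : R) p
    (inner (grad f (x + u + t *: v)) v - inner (grad f (x + t *: v)) v).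
  exact: is_deriveB (is_derive_line _ _ _ _ _ (derive_grad _ _ v (df (x + u + t *: v))))
                    (is_derive_line _ _ _ _ _ (derive_grad _ _ v (df (x + t *: v)))).
have -> : second_diff x u v = p 1 - p 0.
  by rewrite /p !scale1r !scale0r !addr0 /second_diff; ring.
pose a := inner (hess f x *m u) v.
pose b := L / 2 * bnorm B u ^+ 2 * bnorm B v.
pose c := L / 2 * bnorm B u * bnorm B v ^+ 2.
have up := is_derive_cmp _ _ _ _ dp (is_derive_cubic (a + b) c 0).
have lo := is_derive_cmp _ _ _ _ (is_derive_cubic (a - b) (- c) 0) dp.
(* The term [b] is the gradient Taylor error for the displacement [u]; [2 c t] is the cost of moving
   the Hessian from [x + t v] back to [x]. *)
have bnd t : 0 <= t <= 1 ->
    `|inner (grad f (x + u + t *: v)) v - inner (grad f (x + t *: v)) v - a|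
    <= b + 2 * c * t.
  case/andP=> t0 _; rewrite (addrAC x).
  apply: le_trans (ler_distD (inner (hess f (x + t *: v) *m u) v) _ _) _.
  apply: le_trans (lerD (grad_taylor_dist _ _ _) (hess_dist _ _ _ _)) _.
  rewrite (addrAC x) subrr add0r bnormZ ger0_norm // /b /c; lra.
apply/andP; split.
  apply: le_trans (lo _); first by rewrite /K -/a /b /c; lra.
  move=> t /bnd; case/ler_normlP=> h1 h2; lra.
apply: le_trans (up _) _; last by rewrite /K -/a /b /c; lra.
move=> t /bnd; case/ler_normlP=> h1 h2; lra.
Qed.

(** Under scaling of both vectors by [t], the Hessian form scales as [t^2] and the error [K] as
    [t^3], so the asymmetry is at most [t (K a b + K b a)] for every [t > 0]. *)
Lemma hess_sym x u v : inner (hess f x *m u) v = inner (hess f x *m v) u.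
Proof.
suff le_sym a b : inner (hess f x *m a) b <= inner (hess f x *m b) a.
  by apply/le_anti; rewrite !le_sym.
have K0 a' b' : 0 <= K a' b'.
  by rewrite mulr_ge0 ?addr_ge0 ?mulr_ge0 ?exprn_ge0 ?bnorm_ge0 // ltW.
apply/ler_addgt0Pr => e e0.
(* The summand 1 keeps [k] positive, and [t = e / k] makes the asymmetry at most [e]. *)
pose k := K a b + K b a + 1.
have k0 : 0 < k by rewrite ltr_wpDl ?addr_ge0.
pose t := e / k.
have t0 : 0 < t by rewrite divr_gt0.
have KZ a' b' : K (t *: a') (t *: b') = t ^+ 3 * K a' b'.
  by rewrite /K !bnormZ // gtr0_norm //; ring.
have /andP[lo _] := second_diff_bounds x (t *: a) (t *: b).
have /andP[_ up] := second_diff_bounds x (t *: b) (t *: a).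
have sdC : second_diff x (t *: a) (t *: b) = second_diff x (t *: b) (t *: a).
  by rewrite /second_diff [x + _ + _]addrAC; ring.
move: up lo; rewrite sdC !KZ -!scalemxAr !innerZl !innerZr => up lo.
have tk : t * k = e by rewrite divfK ?gt_eqF.
rewrite -subr_ge0 -(pmulr_rge0 _ (exprn_gt0 2 t0)) -tk /k.
have := exprn_gt0 3 t0; lra.
Qed.

End Taylor.

(** * One cubic step: stationarity, decrease and new gradient *)

Lemma quad_ge0_linear_coef {R : realFieldType} (a c : R) :
  (forall s, `|s| <= 1 -> 0 <= s * a + s ^+ 2 * c) -> a = 0.
Proof.
move=> h; pose k := `|c| + `|a| + 1.
have k0 : 0 < k by rewrite ltr_wpDl ?addr_ge0.
have ck : c < k by rewrite /k; have := ler_norm c; have := normr_ge0 a; lra.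
(* Since [k >= |a|], this point is admissible; since [k > c], the value there is negative unless
   [a = 0]. *)
have := h (- a / k); rewrite normrM normrN normfV (gtr0_norm k0) ler_pdivrMr // mul1r.
have -> : `|a| <= k by rewrite /k; have := normr_ge0 c; lra.
move=> /(_ isT).
have -> : - a / k * a + (- a / k) ^+ 2 * c = - ((a / k) ^+ 2 * (k - c)).
  by field; rewrite gt_eqF.
rewrite oppr_ge0 pmulr_lle0 ?subr_gt0 // => h0.
have := sqr_ge0 (a / k); move=> h1; have /eqP : (a / k) ^+ 2 = 0 by apply/le_anti/andP.
by rewrite sqrf_eq0 mulf_eq0 invr_eq0 [k == 0]gt_eqF // orbF => /eqP.
Qed.

(** A first-order expansion of a cubed norm in terms of squared norms, which are polynomial along a
    line. It avoids differentiating the norm, which is not smooth at 0. *)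
Lemma cube_diff_le {R : realFieldType} (u r w : R) : 0 <= u -> 0 <= r -> 0 <= w ->
  `|u - r| <= w ->
  u ^+ 3 - r ^+ 3 <= 3 / 2 * r * (u ^+ 2 - r ^+ 2) + w ^+ 2 * (3 / 2 * r + w).
Proof.
move=> u0 r0 w0 uw.
have -> : u ^+ 3 - r ^+ 3 =
    3 / 2 * r * (u ^+ 2 - r ^+ 2) + (u - r) ^+ 2 * (u + r / 2) by field.
rewrite lerD2l ler_pM ?sqr_ge0 //; first by lra.
  by rewrite -(real_normK (num_real (u - r))) lerXn2r ?nnegrE.
by have := ler_norm (u - r); lra.
Qed.

Section Step.
Context {R : realType} {d : nat} {B : 'M[R]_d} {f : 'cV[R]_d -> R} {L : R}.
Hypothesis Bpos : posdef B.
Hypothesis fC2 : twice_cont_diff f.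
Hypothesis L0 : 0 < L.
Hypothesis fL : hess_lipschitz B f L.
Context {M : R} {x z h : 'cV[R]_d}.
Hypothesis M0 : 0 < M.
Hypothesis stepT : cubic_step B f M x z (x + h).

Let r := bnorm B h.

(** Perturbing the minimizer to [h + s v] changes the model by at most [s a + s^2 c] for [|s| <= 1],
    where [a] is the left-hand side; minimality makes this nonnegative, so [a = 0]. *)
Lemma cubic_step_stationary v :
  inner (grad f x) v + inner (hess f z *m h) v + M / 2 * r * inner (B *m h) v = 0.
Proof.
set w := bnorm B v.
pose c := 2^-1 * inner (hess f z *m v) v
  + M / 6 * (3 / 2 * r * w ^+ 2 + w ^+ 2 * (3 / 2 * r + w)).
apply: (@quad_ge0_linear_coef _ _ c) => s s1.
have := stepT (x + (h + s *: v)).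
have addKl y : x + y - x = y by rewrite addrC addKr.
rewrite /cubic_model !addKl -/r.
have u2 : bnorm B (h + s *: v) ^+ 2 = r ^+ 2 + 2 * s * inner (B *m h) v + s ^+ 2 * w ^+ 2.
  rewrite sqr_bnorm // mulmxDr !(innerDl, innerDr) -scalemxAr !innerZl !innerZr.
  rewrite (innerB_sym Bpos v h) -!sqr_bnorm // -/r -/w; ring.
rewrite mulmxDr -scalemxAr !(innerDl, innerDr) !innerZl !innerZr.
rewrite (hess_sym Bpos fC2 L0 fL z v h).
have := @cube_diff_le _ (bnorm B (h + s *: v)) r (`|s| * w).
rewrite !bnorm_ge0 mulr_ge0 ?bnorm_ge0 // -bnormZ (bnorm_dist Bpos).
move=> /(_ isT isT isT isT).
rewrite bnormZ u2 -/w => cube_le.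
(* The cubic power of [|s|] is absorbed into [s^2] because [|s| <= 1]. *)
have s_le : (`|s| * w) ^+ 2 * (3 / 2 * r + `|s| * w) <= s ^+ 2 * (w ^+ 2 * (3 / 2 * r + w)).
  rewrite exprMn real_normK ?num_real // [leRHS]mulrA.
  rewrite ler_wpM2l ?(mulr_ge0 (sqr_ge0 s) (sqr_ge0 w)) //.
  by rewrite lerD2l ler_piMl ?bnorm_ge0.
have M6 : 0 < M / 6 by rewrite divr_gt0.
have := le_trans cube_le (lerD (lexx _) s_le); rewrite -(ler_pM2l M6) /c.
by move=> {cube_le s_le u2}; lra.
Qed.

Lemma cubic_step_descent_dir : inner (grad f x) h <= 0.
Proof.
have := stepT (x - h).
have addKl y : x + y - x = y by rewrite addrC addKr.
rewrite /cubic_model !addKl bnormN mulmxN innerNl !innerNr opprK.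
by lra.
Qed.

(** In the Taylor bound, replacing the Hessian at [x] by that at [z] costs [L/2 ||x - z|| r^2].
    Stationarity along [h] then leaves [1/2 <grad f x, h> - M/4 r^3], whose first term is
    nonpositive. *)
Lemma cubic_step_progress :
  f (x + h) <= f x - (M / 4 - L / 6) * r ^+ 3 + L / 2 * bnorm B (x - z) * r ^+ 2.
Proof.
have := fun_taylor Bpos fC2 fL x h; rewrite -/r.
have stat : inner (grad f x) h + inner (hess f z *m h) h + M / 2 * r * r ^+ 2 = 0.
  by rewrite /r sqr_bnorm // -/r; exact: cubic_step_stationary.
have := cubic_step_descent_dir.
have := ler_distlDr (hess_dist Bpos fL x z h h); move: stat; rewrite -/r.
(* [lra] would otherwise try to convert the two Hessians by unfolding limits. *)
generalize (inner (hess f z *m h) h) (inner (hess f x *m h) h) => Hz Hx.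
lra.
Qed.

(** After the same change of Hessian, stationarity turns the linear part of the new gradient into
    [- M/2 r <B h, v>], bounded by Cauchy-Schwarz. *)
Lemma cubic_step_grad :
  dual_norm B (grad f (x + h)) <= (L + M) / 2 * r ^+ 2 + L * bnorm B (x - z) * r.
Proof.
have r0 : 0 <= r by exact: bnorm_ge0.
have xz0 : 0 <= bnorm B (x - z) by exact: bnorm_ge0.
apply: (dual_norm_le Bpos) => [|v].
  by rewrite addr_ge0 ?mulr_ge0 ?exprn_ge0 ?invr_ge0 ?addr_ge0 // ltW.
have := grad_taylor_le Bpos fC2 fL x h v; rewrite -/r.
have := cubic_step_stationary v.
have := ler_distlDr (hess_dist Bpos fL x z h v); rewrite -/r.
have := innerB_le Bpos (- h) v.
rewrite bnormN -/r mulmxN innerNl.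
move=> cs; have : M / 2 * r * (- inner (B *m h) v) <= M / 2 * r * (r * bnorm B v).
  by rewrite ler_wpM2l // mulr_ge0 // divr_ge0 // ltW.
generalize (inner (hess f z *m h) v) (inner (hess f x *m h) v) => Hz Hx.
lra.
Qed.

End Step.

(** * Sums over the steps since the last snapshot, and the scalar rate *)

Lemma subn_snapshot_le m i : (0 < m)%N -> (i - snapshot m i <= m)%N.
Proof. by move=> m0; rewrite subKn ?leq_mod // ltnW ?ltn_pmod. Qed.

Lemma sum_window_le {R : realType} (b : nat -> R) (m k : nat) :
  (0 < m)%N -> (forall i, 0 <= b i) ->
  \sum_(0 <= i < k) \sum_(snapshot m i <= j < i) b j
    <= m%:R * \sum_(0 <= j < k) b j.
Proof.
move=> m0 b0.
have -> : \sum_(0 <= i < k) \sum_(snapshot m i <= j < i) b j =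
    \sum_(0 <= i < k) \sum_(0 <= j < k | (snapshot m i <= j < i)%N) b j.
  apply: eq_big_nat => i /andP[_ ik].
  rewrite (big_nat_widen _ i k) ?(ltnW ik) // (big_nat_widenl _ 0) //.
  by apply: eq_bigl => j; rewrite andbC.
rewrite (exchange_big_dep_nat predT) //= mulr_sumr.
apply: ler_sum => j _; rewrite -big_filter big_const_seq count_predT iter_addr_0.
rewrite mulr_natl; apply: ler_wpMn2l => //.
(* After the exchange of sums, [b j] is counted once for each [i] whose window contains [j]; such
   [i] satisfy [j < i <= j + m]. *)
rewrite -[leqRHS](size_iota j.+1 m); apply: uniq_leq_size.
  by rewrite filter_uniq ?iota_uniq.
move=> i; rewrite mem_filter !mem_iota => /andP[/andP[sj ji] _].
rewrite ji /= addSn ltnS; move: sj; rewrite /snapshot leq_subLR => /leq_trans; apply.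
by rewrite addnC leq_add2l ltnW ?ltn_pmod.
Qed.

Lemma sum_window_cube_le {R : realType} (a : nat -> R) (m i : nat) :
  (0 < m)%N -> (forall i, 0 <= a i) ->
  (\sum_(snapshot m i <= j < i) a j) ^+ 3
    <= m%:R ^+ 2 * \sum_(snapshot m i <= j < i) a j ^+ 3.
Proof.
move=> m0 a0; set S := \sum_(_ <= _ < _) a _.
have mR : 0 < m%:R :> R by rewrite ltr0n.
have S0 : 0 <= S by apply: sumr_ge0.
pose t := S / m%:R.
have t0 : 0 <= t by rewrite divr_ge0 // ltW.
(* The tangent line of [a ^ 3] at the mean [t] gives the power mean inequality. *)
have tangent j : 3 * t ^+ 2 * a j - 2 * t ^+ 3 <= a j ^+ 3.
  rewrite -subr_ge0.
  have -> : a j ^+ 3 - (3 * t ^+ 2 * a j - 2 * t ^+ 3) =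
    (a j - t) ^+ 2 * (a j + 2 * t) by ring.
  by rewrite mulr_ge0 ?sqr_ge0 ?addr_ge0 ?mulr_ge0.
have := @ler_sum_nat R (snapshot m i) i _ _ (fun j _ => tangent j).
rewrite big_split /= -mulr_sumr -/S sumr_const_nat => sum_tangent.
(* The window may have fewer than [m] terms, but the constant of the tangent line is subtracted, so
   counting it [m] times only weakens the bound. *)
have le_m : (2 * t ^+ 3) *+ (i - snapshot m i) <= m%:R * (2 * t ^+ 3).
  rewrite (mulr_natl _ m); apply: ler_wpMn2l; last exact: subn_snapshot_le.
  by rewrite mulr_ge0 ?exprn_ge0.
have -> : S ^+ 3 = m%:R ^+ 2 * (3 * t ^+ 2 * S - m%:R * (2 * t ^+ 3)).
  by rewrite /t; field; rewrite gt_eqF.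
rewrite ler_wpM2l ?exprn_ge0 //; apply: le_trans _ sum_tangent.
by rewrite mulNrn lerD2l lerN2.
Qed.

(** Young's inequality [a_j a_i^2 <= a_j^3 / 3 + 2 a_i^3 / 3]; summation gives shares [m/3] and
    [2m/3] of the total. *)
Lemma sum_window_sqr_le {R : realType} (a : nat -> R) (m k : nat) :
  (0 < m)%N -> (forall i, 0 <= a i) ->
  \sum_(0 <= i < k) (\sum_(snapshot m i <= j < i) a j) * a i ^+ 2
    <= m%:R * \sum_(0 <= i < k) a i ^+ 3.
Proof.
move=> m0 a0.
have step i : (\sum_(snapshot m i <= j < i) a j) * a i ^+ 2 <=
    3^-1 * \sum_(snapshot m i <= j < i) a j ^+ 3 + 2 / 3 * m%:R * a i ^+ 3.
  apply: (@le_trans _ _ (\sum_(snapshot m i <= j < i)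
      (3^-1 * a j ^+ 3 + 2 / 3 * a i ^+ 3))).
    rewrite mulr_suml; apply: ler_sum => j _; rewrite -subr_ge0.
    have -> : 3^-1 * a j ^+ 3 + 2 / 3 * a i ^+ 3 - a j * a i ^+ 2 =
      (a j - a i) ^+ 2 * (a j + 2 * a i) / 3 by field.
    by rewrite divr_ge0 // mulr_ge0 ?sqr_ge0 // addr_ge0 // mulr_ge0.
  rewrite big_split /= -mulr_sumr lerD2l sumr_const_nat [leRHS]mulrAC [leRHS]mulr_natr.
  apply: ler_wpMn2l; last exact: subn_snapshot_le.
  by rewrite mulr_ge0 ?exprn_ge0.
apply: le_trans (ler_sum_nat (fun i _ => step i)) _.
rewrite big_split /= -!mulr_sumr.
have := sum_window_le (fun i => a i ^+ 3) m k m0 (fun i => exprn_ge0 3 (a0 i)).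
lra.
Qed.

(** The scalar core: [F] stands for function values, [r] for step lengths, and [e] for the square
    root of the gradient threshold, so that [e^3] is its power 3/2. *)
Lemma lazy_rate {R : realType} (F r : nat -> R) (L e : R) (m k : nat) :
  (0 < m)%N -> 0 < L -> 0 <= e -> (forall i, 0 <= r i) ->
  let M := 6 * m%:R * L in
  let S i := \sum_(snapshot m i <= j < i) r j in
  (forall i, F i.+1 <= F i - (M / 4 - L / 6) * r i ^+ 3 + L / 2 * S i * r i ^+ 2) ->
  (forall i, (i < k)%N -> e ^+ 2 <= (L + M) / 2 * r i ^+ 2 + L * S i * r i) ->
  k%:R * e ^+ 3 <= 44 * Num.sqrt (m%:R * L) * (F 0%N - F k).
Proof.
move=> m0 L0 e0 r0 M S dec grd.
have mR : 1 <= m%:R :> R by rewrite ler1n.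
have mL0 : 0 < m%:R * L by rewrite mulr_gt0 // ltr0n.
set q := Num.sqrt _; have q0 : 0 < q by rewrite sqrtr_gt0.
have q2 : q ^+ 2 = m%:R * L by rewrite sqr_sqrtr // ltW.
have S0 i : 0 <= S i by apply: sumr_ge0.
pose Sg := \sum_(0 <= i < k) r i ^+ 3.
(* The coefficient is [M/4 - L/6 - m L/2 = m L - L/6], at least [5/6 m L] as [m >= 1]. *)
have progress : 5 / 6 * (m%:R * L) * Sg <= F 0%N - F k.
  have tel : \sum_(0 <= i < k) (F i - F i.+1) = F 0%N - F k.
    rewrite -[RHS]opprB -telescope_sumr // -sumrN.
    by apply: eq_bigr => i _; rewrite opprB.
  have low i : (M / 4 - L / 6) * r i ^+ 3 - L / 2 * (S i * r i ^+ 2) <= F i - F i.+1.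
    by have := dec i; lra.
  have := @ler_sum_nat R 0 k _ _ (fun i _ => low i).
  rewrite tel big_split sumrN /= -!mulr_sumr -/Sg; apply: le_trans.
  have := sum_window_sqr_le r m k m0 r0; rewrite -/Sg => sq.
  have : L / 2 * \sum_(0 <= i < k) S i * r i ^+ 2 <= L / 2 * (m%:R * Sg).
    by rewrite ler_wpM2l // divr_ge0 // ltW.
  have Sg0 : 0 <= Sg by apply: sumr_ge0 => i _; rewrite exprn_ge0.
  have : L * Sg <= m%:R * (L * Sg) by rewrite ler_peMl // mulr_ge0 // ltW.
  rewrite /M; lra.
have grad i : (i < k)%N ->
    e ^+ 3 <= 4 * (8 * q ^+ 3 * r i ^+ 3 + q ^+ 3 / m%:R ^+ 3 * S i ^+ 3).
  (* Chosen so that [(A + C)^2 = 4 m L r^2 + 4 L r S + C^2] dominates the gradient bound, whose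
     [r^2] coefficient is [3 m L + L/2]. Then [(A + C)^3 <= 4 (A^3 + C^3)]. *)
  move=> ik; pose A := 2 * q * r i; pose C := q * S i / m%:R.
  have A0 : 0 <= A by rewrite !mulr_ge0 // ltW.
  have C0 : 0 <= C by rewrite divr_ge0 ?mulr_ge0 // ltW.
  have eAC : e <= A + C.
    rewrite -(ler_pXn2r (n := 2)) ?nnegrE ?addr_ge0 //.
    apply: le_trans (grd i ik) _.
    have -> : (A + C) ^+ 2 = 4 * q ^+ 2 * r i ^+ 2
        + 4 * (q ^+ 2 / m%:R) * (r i * S i) + C ^+ 2.
      by rewrite /A /C; field; rewrite pnatr_eq0 -lt0n.
    have -> : q ^+ 2 / m%:R = L by rewrite q2 mulrAC mulfV ?mul1r // pnatr_eq0 -lt0n.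
    rewrite q2; have := sqr_ge0 C.
    have : L * (r i * S i) >= 0 by rewrite !mulr_ge0 // ltW.
    have : L * r i ^+ 2 <= m%:R * (L * r i ^+ 2).
      by rewrite ler_peMl // mulr_ge0 ?exprn_ge0 // ltW.
    have : 0 <= L * r i ^+ 2 by rewrite mulr_ge0 ?exprn_ge0 // ltW.
    rewrite /M; lra.
  apply: (@le_trans _ _ ((A + C) ^+ 3)); first by rewrite lerXn2r ?nnegrE ?addr_ge0.
  have -> : 8 * q ^+ 3 * r i ^+ 3 + q ^+ 3 / m%:R ^+ 3 * S i ^+ 3 = A ^+ 3 + C ^+ 3.
    by rewrite /A /C; field; rewrite pnatr_eq0 -lt0n.
  rewrite -subr_ge0.
  have -> : 4 * (A ^+ 3 + C ^+ 3) - (A + C) ^+ 3 = 3 * (A + C) * (A - C) ^+ 2 by ring.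
  by rewrite mulr_ge0 ?sqr_ge0 ?mulr_ge0 ?addr_ge0.
have cubes : \sum_(0 <= i < k) S i ^+ 3 <= m%:R ^+ 3 * Sg.
  apply: le_trans (ler_sum_nat (fun i _ => sum_window_cube_le r m i m0 r0)) _.
  rewrite -mulr_sumr [m%:R ^+ 3]exprSr -mulrA ler_wpM2l ?exprn_ge0 //.
  by apply: (sum_window_le (fun i => r i ^+ 3)) => // i; rewrite exprn_ge0.
have := @ler_sum_nat R 0 k _ _ (fun i => grad i).
rewrite sumr_const_nat subn0 -mulr_sumr big_split /= -!mulr_sumr -/Sg (mulr_natl _ k).
move=> le1; apply: le_trans le1 _.
have q3 : 0 <= q ^+ 3 / m%:R ^+ 3 by rewrite divr_ge0 ?exprn_ge0 // ltW.
have := ler_wpM2l q3 cubes.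
have -> : q ^+ 3 / m%:R ^+ 3 * (m%:R ^+ 3 * Sg) = q * (m%:R * L) * Sg.
  by rewrite -q2; field; rewrite pnatr_eq0 -lt0n.
have := ler_wpM2l (ltW q0) progress.
have -> : 8 * q ^+ 3 * Sg = 8 * (q * (m%:R * L) * Sg) by rewrite -q2; ring.
have : 0 <= q * (m%:R * L) * Sg.
  apply: mulr_ge0; first by rewrite mulr_ge0 // ltW.
  by apply: sumr_ge0 => i _; rewrite exprn_ge0.
(* The constants combine to [4 (8 + 1) 6/5 = 43.2 <= 44]. *)
set P := \sum_(0 <= i < k) S i ^+ 3; lra.
Qed.

Lemma bnorm_path {R : realType} {d : nat} {B : 'M[R]_d} (x : nat -> 'cV[R]_d) s i :
  posdef B -> (s <= i)%N ->
  bnorm B (x i - x s) <= \sum_(s <= j < i) bnorm B (x j.+1 - x j).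
Proof.
move=> Bpos si; rewrite -(telescope_sumr x si).
apply: (big_ind2 (fun u a => bnorm B u <= a)) => // [|u a v b ua vb].
  by rewrite /bnorm mulmx0 inner0l sqrtr0.
by apply: le_trans (bnormD Bpos u v) _; rewrite lerD.
Qed.

(** * Fractional powers and the trade-off function *)

Lemma powR32 {R : realType} (a : R) : 0 <= a -> a `^ (3 / 2) = Num.sqrt a ^+ 3.
Proof.
move=> a0; rewrite mulrC powRrM powR12_sqrt //.
by rewrite -(powR_mulrn 3 (sqrtr_ge0 a)).
Qed.

(** Raising the cap on [e] to the power 3/2 gives [e^(3/2) <= D sqrt (L / s)]. *)
Lemma sqrt_le_rate {R : realType} (D L s e : R) :
  0 <= D -> 0 < L -> 0 < s -> 0 < e ->
  e <= D `^ (2 / 3) * (L / s) `^ (1 / 3) ->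
  Num.sqrt s <= Num.sqrt L * D / e `^ (3 / 2).
Proof.
move=> D0 L0 s0 e0 h.
have Ls0 : 0 <= L / s by rewrite divr_ge0 // ltW.
have ep : 0 < e `^ (3 / 2) by rewrite powR_gt0.
have h32 : 0 <= 3 / 2 :> R by lra.
have := ge0_ler_powR h32 _ _ h.
rewrite !nnegrE mulr_ge0 ?powR_ge0 // ltW // => /(_ isT isT).
rewrite powRM ?powR_ge0 // -!powRrM.
have -> : 2 / 3 * (3 / 2) = 1 :> R by field.
have -> : 1 / 3 * (3 / 2) = 2^-1 :> R by field.
rewrite powRr1 // powR12_sqrt // sqrtrM ?(ltW L0) // sqrtrV ?(ltW s0) //.
rewrite mulrA ler_pdivlMr ?sqrtr_gt0 // => h1.
by rewrite ler_pdivlMr // mulrC (mulrC _ D).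
Qed.

(** AM-GM: with [q = sqrt s] and [p = sqrt d], the gap is [(q - p)^2 / q]. *)
Lemma tradeoff_ge {R : realType} (d : nat) (s : R) : 0 < s ->
  2 * Num.sqrt d%:R <= tradeoff d s.
Proof.
move=> s0; rewrite /tradeoff; set q := Num.sqrt s.
have q0 : 0 < q by rewrite sqrtr_gt0.
rewrite -{2}(sqr_sqrtr (ler0n R d)) -subr_ge0.
set p := Num.sqrt _.
have -> : q + p ^+ 2 / q - 2 * p = (q - p) ^+ 2 / q by field; rewrite gt_eqF.
by rewrite divr_ge0 ?sqr_ge0 // ltW.
Qed.

Lemma tradeoff_self {R : realType} (d : nat) :
  tradeoff d (d%:R : R) = 2 * Num.sqrt d%:R.
Proof.
rewrite /tradeoff; set p := Num.sqrt _.
(* For [d = 0] the identity rests on the convention that the inverse of 0 is 0. *)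
have [p0|p0] := eqVneq p 0; first by rewrite p0 invr0 !mulr0 addr0.
by rewrite -(sqr_sqrtr (ler0n R d)) -/p; field.
Qed.

(** * Iteration count and arithmetic cost of the method *)

Section LazyNewton.
Context {R : realType} {d : nat} {B : 'M[R]_d} {f : 'cV[R]_d -> R}.
Context {fstar L gradcost hesscost : R} {x0 : 'cV[R]_d} {eps : R}.
Hypothesis Bpos : posdef B.
Hypothesis fC2 : twice_cont_diff f.
Hypothesis f_ge : forall x, fstar <= f x.
Hypothesis L0 : 0 < L.
Hypothesis fL : hess_lipschitz B f L.
Hypothesis G0 : 0 < gradcost.
Hypothesis hessE : hesscost = d%:R * gradcost.
Hypothesis eps0 : 0 < eps.

Let Delta := f x0 - fstar.
Let rate := Num.sqrt L * Delta / eps `^ (3 / 2).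

Lemma lazy_newton_iterations (m k : nat) (x : nat -> 'cV[R]_d) : (0 < m)%N ->
  lazy_cubic_newton B f (6 * m%:R * L) m x0 x ->
  (forall i, (1 <= i <= k)%N -> eps <= dual_norm B (grad f (x i))) ->
  k%:R <= 44 * Num.sqrt m%:R * rate.
Proof.
move=> m0 [x00 step] grd.
pose M := 6 * m%:R * L.
have M0 : 0 < M by rewrite !mulr_gt0 // ltr0n.
pose r i := bnorm B (x i.+1 - x i).
pose S i := \sum_(snapshot m i <= j < i) r j.
have r0 i : 0 <= r i by exact: bnorm_ge0.
have xS i : bnorm B (x i - x (snapshot m i)) <= S i.
  by apply: bnorm_path => //; exact: leq_subr.
have stepi i : cubic_step B f M (x i) (x (snapshot m i)) (x i + (x i.+1 - x i)).
  by rewrite addrC subrK; exact: step.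
have dec i : f (x i.+1) <=
    f (x i) - (M / 4 - L / 6) * r i ^+ 3 + L / 2 * S i * r i ^+ 2.
  have := cubic_step_progress Bpos fC2 L0 fL M0 (stepi i).
  rewrite [x i + _]addrC subrK => /le_trans; apply.
  by rewrite lerD2l ler_wpM2r ?exprn_ge0 ?bnorm_ge0 // ler_wpM2l ?xS // divr_ge0 // ltW.
(* Step [i] controls the gradient at iterate [i + 1], so indices [i < k] match the thresholds at
   [1, ..., k]. *)
have e2 i : (i < k)%N ->
    Num.sqrt eps ^+ 2 <= (L + M) / 2 * r i ^+ 2 + L * S i * r i.
  move=> ik; rewrite sqr_sqrtr ?(ltW eps0) //; apply: le_trans (grd i.+1 ik) _.
  have := cubic_step_grad Bpos fC2 L0 fL M0 (stepi i).
  rewrite [x i + _]addrC subrK => /le_trans; apply.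
  by rewrite lerD2l ler_wpM2r ?bnorm_ge0 // ler_wpM2l ?xS // ltW.
have := lazy_rate (f \o x) r L (Num.sqrt eps) m k m0 L0 (sqrtr_ge0 _) r0 dec e2.
rewrite -powR32 ?(ltW eps0) // /rate mulrA => h.
rewrite ler_pdivlMr ?powR_gt0 //; apply: le_trans h _.
rewrite sqrtrM ?ler0n // /= x00 !mulrA.
apply: ler_wpM2l; first by rewrite !mulr_ge0 ?sqrtr_ge0.
by rewrite lerD2l lerN2.
Qed.

Lemma lazy_newton_complexity (m : nat) : (0 < m)%N ->
  eps <= Delta `^ (2 / 3) * (L / m%:R) `^ (1 / 3) ->
  complexity_at_most B f L gradcost hesscost x0 eps m
    (50 * (tradeoff d (m%:R : R) * rate) * gradcost).
Proof.
move=> m0 eps_le x k run k1 grd.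
have mR : 0 < m%:R :> R by rewrite ltr0n.
have k_le := lazy_newton_iterations m k x m0 run grd.
have D0 : 0 <= Delta by rewrite subr_ge0.
have q_le : Num.sqrt m%:R <= rate by exact: sqrt_le_rate.
rewrite /total_cost /num_hessians /tradeoff hessE [_ * (d%:R * _)]mulrA -mulrDl ler_pM2r //.
have ceil_le : (Num.ceil (k%:R / m%:R : R))%:~R <= k%:R / m%:R + 1 :> R.
  by have := ceilB1_lt (k%:R / m%:R : R); rewrite intrB; lra.
have q0 : 0 < Num.sqrt m%:R :> R by rewrite sqrtr_gt0.
have qm : m%:R = Num.sqrt m%:R ^+ 2 :> R by rewrite sqr_sqrtr // ltW.
have kq : k%:R / m%:R <= 44 * (rate / Num.sqrt m%:R).
  rewrite ler_pdivrMr // {2}qm.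
  have -> : 44 * (rate / Num.sqrt m%:R) * Num.sqrt m%:R ^+ 2 =
    44 * Num.sqrt m%:R * rate by field; rewrite gt_eqF.
  exact: k_le.
(* This absorbs the rounding of the ceiling: the Hessian count is at most [44 + 1 = 45] times
   [rate / sqrt m]. *)
have q1 : 1 <= rate / Num.sqrt m%:R by rewrite ler_pdivlMr // mul1r.
have hess_le : (Num.ceil (k%:R / m%:R : R))%:~R * d%:R
    <= 45 * (rate / Num.sqrt m%:R) * d%:R :> R.
  by rewrite ler_wpM2r //; lra.
have rate0 : 0 <= rate by apply: le_trans q_le; exact: sqrtr_ge0.
have gq0 : 0 <= Num.sqrt m%:R * rate by rewrite mulr_ge0 // ltW.
have hq0 : 0 <= rate / Num.sqrt m%:R * d%:R.
  by rewrite mulr_ge0 // (le_trans ler01).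
have -> : 50 * ((Num.sqrt m%:R + d%:R / Num.sqrt m%:R) * rate) =
  50 * (Num.sqrt m%:R * rate) + 50 * (rate / Num.sqrt m%:R * d%:R) by ring.
lra.
Qed.

End LazyNewton.

Theorem corollary3p6 (R : realType) :
  (forall (d : nat), (1 <= d)%N ->
     forall s : R, 1 <= s -> tradeoff d (d%:R : R) <= tradeoff d s) /\
  exists2 C : R, 0 < C &
    forall (d : nat) (B : 'M[R]_d) (f : 'cV[R]_d -> R) (fstar L : R)
           (gradcost hesscost : R) (x0 : 'cV[R]_d) (eps : R),
      (1 <= d)%N ->
      posdef B ->
      twice_cont_diff f ->
      (forall x, fstar <= f x) ->
      0 < L ->
      hess_lipschitz B f L ->
      0 < gradcost ->
      hesscost = d%:R * gradcost ->
      0 < eps ->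
      let Delta := f x0 - fstar in
      let rate := Num.sqrt L * Delta / eps `^ (3 / 2) in
      let bound (m : nat) := C * (tradeoff d (m%:R : R) * rate) * gradcost in
      [/\ (* the bound is valid for every m, and minimal at m = d *)
          forall m : nat, (1 <= m)%N ->
            eps <= Delta `^ (2 / 3) * (L / m%:R) `^ (1 / 3) ->
            complexity_at_most B f L gradcost hesscost x0 eps m (bound m),
          forall m : nat, (1 <= m)%N -> bound d <= bound m,
          (* lazy Hessians with m = d *)
          eps <= Delta `^ (2 / 3) * (L / d%:R) `^ (1 / 3) ->
            complexity_at_most B f L gradcost hesscost x0 eps d
              (C * Num.sqrt d%:R * rate * gradcost),
          (* full cubic Newton, m = 1 *)
          eps <= Delta `^ (2 / 3) * L `^ (1 / 3) ->
            complexity_at_most B f L gradcost hesscost x0 eps 1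
              (C * d%:R * rate * gradcost)
        & (* improvement factor *)
          C * d%:R * rate * gradcost
            = Num.sqrt d%:R * (C * Num.sqrt d%:R * rate * gradcost)].
Proof.
split=> [d _ s s1|].
  by rewrite tradeoff_self tradeoff_ge // (lt_le_trans ltr01).
(* Twice the 50 of the general bound: the trade-off is [2 sqrt d] at [m = d], and [1 + d <= 2 d] at
   [m = 1]. *)
exists 100 => [|d B f fstar L gradcost hesscost x0 eps d0 Bpos fC2 f_ge L0 fL G0 hessE eps0];
  first by rewrite ltr0n.
move=> Delta rate bound.
have D0 : 0 <= Delta by rewrite subr_ge0.
have rateG0 : 0 <= rate * gradcost.
  by rewrite !mulr_ge0 ?invr_ge0 ?powR_ge0 ?sqrtr_ge0 // ltW.
have core m := @lazy_newton_complexity _ _ _ _ _ _ _ _ x0 _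
  Bpos fC2 f_ge L0 fL G0 hessE eps0 m.
have relax m U : complexity_at_most B f L gradcost hesscost x0 eps m
      (50 * (tradeoff d (m%:R : R) * rate) * gradcost) ->
    50 * tradeoff d (m%:R : R) * (rate * gradcost) <= U ->
    complexity_at_most B f L gradcost hesscost x0 eps m U.
  move=> h hU x k run k1 grd; apply: le_trans (h x k run k1 grd) _.
  by apply: le_trans hU; rewrite !mulrA.
have sqrt_d := sqr_sqrtr (ler0n R d).
have d1 : 1 <= d%:R :> R by rewrite ler1n.
have boundE m : bound m = 100 * tradeoff d (m%:R : R) * (rate * gradcost).
  by rewrite /bound !mulrA.
have tradeoff_ge_self m : (0 < m)%N -> tradeoff d (d%:R : R) <= tradeoff d (m%:R : R).
  by move=> m0; rewrite tradeoff_self tradeoff_ge ?ltr0n.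
split.
- move=> m m0 eps_le; apply: relax _ _ (core m m0 eps_le) _.
  rewrite boundE ler_wpM2r // ler_wpM2r ?ler_nat //.
  by apply: le_trans (tradeoff_ge_self m m0); rewrite tradeoff_self mulr_ge0 ?sqrtr_ge0.
- by move=> m m0; rewrite !boundE ler_wpM2r // ler_wpM2l // tradeoff_ge_self.
- move=> eps_le; apply: relax _ _ (core d d0 eps_le) _.
  by rewrite -[leRHS]mulrA ler_wpM2r // tradeoff_self mulrA -natrM.
- rewrite -{1}(divr1 L) => eps_le; apply: relax _ _ (core 1%N isT eps_le) _.
  rewrite -[leRHS]mulrA ler_wpM2r // /tradeoff sqrtr1 divr1; lra.
- by rewrite -{1}sqrt_d; ring.
Qed.
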